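(* The lattice $\mathrm{Quo}(3)$ of all quasiorders of a three-element set is $(1+1+2)$-generated.
   Context: A quasiorder (preorder) of a set $A$ is a reflexive and transitive relation $\rho\subseteq A^2$. The set $\mathrm{Quo}(A)$ of all quasiorders of $A$, ordered by set inclusion, is a lattice, called the quasiorder lattice of $A$: the meet is $\rho\wedge\tau=\rho\cap\tau$ and the join $\rho\vee\tau$ is the transitive closure of $\rho\cup\tau$. For $n$ a positive integer, $\mathrm{Quo}(n)$ denotes (up to isomorphism) $\mathrm{Quo}(A)$ for an $n$-element set $A$. A four-element subset $X$ of a poset $Y$ is a $(1+1+2)$-subset of $Y$ if exactly two elements of $X$ are comparable (that is, exactly one unordered pair of distinct elements of $X$ is comparable). A $(1+1+2)$-generating set of a lattice $L$ is a $(1+1+2)$-subset $X$ of $L$ that generates $L$ (the smallest sublattice of $L$, i.e. subset closed under binary $\wedge$ and $\vee$, containing $X$ is $L$ itself). A lattice is $(1+1+2)$-generated if it has a $(1+1+2)$-generating set. *)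

(* Defs.v *)
From HB Require Import structures.
From mathcomp Require Import all_boot all_order finmap.

Set Implicit Arguments.
Unset Strict Implicit.
Unset Printing Implicit Defensive.

Import Order.Theory.

Definition rel_of (A : finType) (r : {set A * A}) : rel A :=
  fun x y => (x, y) \in r.

Definition quasiorder (A : finType) (r : {set A * A}) : bool :=
  [forall x, rel_of r x x] &&
  [forall x, forall y, forall z,
     rel_of r x y ==> rel_of r y z ==> rel_of r x z].

Lemma quasiorderP (A : finType) (r : {set A * A}) :
  reflect (reflexive (rel_of r) /\ transitive (rel_of r)) (quasiorder r).
Proof.
apply: (iffP andP) => [[/forallP r_refl r_tr]|[r_refl r_tr]]; split=> //.
- move=> y x z xy yz.
  by move/forallP/(_ x)/forallP/(_ y)/forallP/(_ z): r_tr; rewrite xy yz.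
- by apply/forallP.
- apply/forallP=> x; apply/forallP=> y; apply/forallP=> z.
  by apply/implyP=> xy; apply/implyP; apply: r_tr xy.
Qed.

Record Quo (A : finType) := MkQuo {
  quo_set :> {set A * A};
  _ : quasiorder quo_set
}.

HB.instance Definition _ (A : finType) := [isSub for @quo_set A].
HB.instance Definition _ (A : finType) := [Finite of Quo A by <:].

Section QuoLattice.

Variable A : finType.
Implicit Types r s t : Quo A.

Lemma quo_refl r : reflexive (rel_of r).
Proof. by case/quasiorderP: (valP r). Qed.

Lemma quo_trans r : transitive (rel_of r).
Proof. by case/quasiorderP: (valP r). Qed.

Definition quo_le r s : bool := quo_set r \subset quo_set s.

Lemma quo_le_refl : reflexive quo_le.
Proof. by move=> r; apply: subxx. Qed.

Lemma quo_le_anti : antisymmetric quo_le.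
Proof. by move=> r s rs; apply/val_inj/eqP; rewrite eqEsubset. Qed.

Lemma quo_le_trans : transitive quo_le.
Proof. by move=> s r t; apply: subset_trans. Qed.

Lemma quo_meet_subproof r s : quasiorder (quo_set r :&: quo_set s).
Proof.
apply/quasiorderP; split=> [x|y x z]; rewrite /rel_of !inE.
  by apply/andP; split; apply: quo_refl.
move=> /andP[rxy sxy] /andP[ryz syz].
by apply/andP; split; [apply: quo_trans rxy ryz | apply: quo_trans sxy syz].
Qed.

Definition quo_meet r s : Quo A := MkQuo (quo_meet_subproof r s).

(* [connect] is the reflexive transitive closure; it is the transitive       *)
(* closure here because r :|: s is already reflexive.                         *)
Definition quo_join_set r s : {set A * A} :=
  [set p | connect (rel_of (quo_set r :|: quo_set s)) p.1 p.2].

Lemma quo_join_subproof r s : quasiorder (quo_join_set r s).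
Proof.
apply/quasiorderP; split=> [x|y x z]; rewrite /rel_of !inE //=.
exact: connect_trans.
Qed.

Definition quo_join r s : Quo A := MkQuo (quo_join_subproof r s).

Lemma quo_meetP r s t : quo_le r (quo_meet s t) = quo_le r s && quo_le r t.
Proof. exact: subsetI. Qed.

Lemma quo_joinP r s t : quo_le (quo_join r s) t = quo_le r t && quo_le s t.
Proof.
rewrite /quo_le -subUset; apply/subsetP/subsetP=> rs_t [x y] xy.
  by apply: rs_t; rewrite inE; apply: connect1.
move: xy; rewrite inE /= => /connectP[p p_path ->] {y}.
elim: p x p_path => [|z p IHp] x /=; first by move=> _; apply: quo_refl.
case/andP=> xz /IHp; apply: (@quo_trans t z x); exact: rs_t.
Qed.

End QuoLattice.

Fact quo_display : Order.disp_t. Proof. exact: Order.Disp tt tt. Qed.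

HB.instance Definition _ (A : finType) :=
  Order.Le_isPOrder.Build quo_display (Quo A)
    (@quo_le_refl A) (@quo_le_anti A) (@quo_le_trans A).

HB.instance Definition _ (A : finType) :=
  Order.POrder_MeetJoin_isLattice.Build quo_display (Quo A)
    (@quo_meetP A) (@quo_joinP A).

Local Open Scope order_scope.
Local Open Scope fset_scope.

Definition comparable_pair (d : Order.disp_t) (Y : porderType d)
    (P : {fset Y}) : Prop :=
  exists x y : Y, [/\ P = [fset x; y], x != y & x >=< y].

Definition one_one_two_subset (d : Order.disp_t) (Y : porderType d)
    (X : {fset Y}) : Prop :=
  #|` X| = 4%N /\ exists! P : {fset Y}, P `<=` X /\ comparable_pair P.

(* Sublattices are Prop-valued so that the notion is also the usual one for   *)
(* infinite L.                                                                *)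
Definition sublattice (d : Order.disp_t) (L : latticeType d)
    (S : L -> Prop) : Prop :=
  forall x y : L, S x -> S y ->
    S (Order.meet x y) /\ S (Order.join x y).

Definition generated_sublattice (d : Order.disp_t) (L : latticeType d)
    (X : {fset L}) (x : L) : Prop :=
  forall S : L -> Prop, sublattice S -> (forall y, y \in X -> S y) -> S x.

Definition generates (d : Order.disp_t) (L : latticeType d)
    (X : {fset L}) : Prop :=
  forall x : L, generated_sublattice X x.

Definition one_one_two_generated (d : Order.disp_t) (L : latticeType d) : Prop :=
  exists X : {fset L}, one_one_two_subset X /\ generates X.

(* Main.v *)
Require Import Defs.
From mathcomp Require Import all_boot all_order finmap.

(** Write [arrow x y] for the least quasiorder relating [x] to [y], and
    [merge x y] for the least one relating [x] and [y] both ways.  On a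
    three-element set [{a, b, c}] the generating set is
    [{arrow a b, merge a b, merge a c, merge b c}]: the three merges are
    pairwise incomparable, and [arrow a b] lies below [merge a b] only.

    The merges allow an arrow to be moved around.  In [arrow x y \/ merge y z]
    the element [x] reaches [z] through [y], but nothing other than [x] reaches
    [x]; meeting with [merge x z] therefore leaves exactly [arrow x z]
    ([arrow_retarget]).  Reversing all relations, the source of an arrow can be
    replaced as well ([arrow_resource]).  Starting from [arrow a b], these moves
    yield
      a->c, c->b  from a->b,   b->c  from a->c,   b->a  from b->c,
      c->a  from c->b,
    hence all six proper arrows, and the diagonal is the meet of two of them.
    Every quasiorder is the join of the arrows below it
    ([sublattice_of_arrows]), so the generated sublattice is everything. *)

Set Implicit Arguments.
Unset Strict Implicit.
Unset Printing Implicit Defensive.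

Import Order.Theory.
Local Open Scope order_scope.
Local Open Scope fset_scope.

Section ArrowsAndMerges.

Variable A : finType.
Implicit Types (x y z u v : A) (r s t : Quo A).

Lemma quo_leP r s :
  reflect (forall u v, (u, v) \in quo_set r -> (u, v) \in quo_set s) (r <= s).
Proof.
apply: (iffP subsetP) => [rs u v|rs [u v]]; exact: rs.
Qed.

Lemma mem_quo_trans r y x z :
  (x, y) \in quo_set r -> (y, z) \in quo_set r -> (x, z) \in quo_set r.
Proof. exact: (@quo_trans A r y x z). Qed.

Lemma mem_quo_meet r s (p : A * A) :
  (p \in quo_set (Order.meet r s)) = (p \in quo_set r) && (p \in quo_set s).
Proof. exact: in_setI. Qed.

Lemma arrow_subproof x y :
  quasiorder [set p : A * A | (p.1 == p.2) || (p == (x, y))].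
Proof.
apply/quasiorderP; split=> [u|v u w]; rewrite /rel_of !inE /= ?eqxx //.
case/orP=> [/eqP->|/eqP[-> ->]] //.
by case/orP=> [/eqP<-|/eqP[-> ->]]; rewrite eqxx ?orbT.
Qed.

Definition arrow x y : Quo A := MkQuo (arrow_subproof x y).

Lemma in_arrow x y u v :
  ((u, v) \in quo_set (arrow x y)) = (u == v) || (u == x) && (v == y).
Proof. by rewrite inE. Qed.

Lemma merge_subproof x y :
  quasiorder [set p : A * A |
    (p.1 == p.2) || (p.1 \in pred2 x y) && (p.2 \in pred2 x y)].
Proof.
apply/quasiorderP; split=> [u|v u w]; rewrite /rel_of !inE /= ?eqxx //.
case/orP=> [/eqP->|/andP[uxy vxy]] //.
by case/orP=> [/eqP<-|/andP[_ wxy]]; apply/orP; right; apply/andP.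
Qed.

Definition merge x y : Quo A := MkQuo (merge_subproof x y).

Lemma in_merge x y u v :
  ((u, v) \in quo_set (merge x y)) =
  (u == v) || ((u == x) || (u == y)) && ((v == x) || (v == y)).
Proof. by rewrite !inE. Qed.

Lemma merge_sym x y : merge x y = merge y x.
Proof.
by apply/val_inj/setP=> -[u v]; rewrite !in_merge orbC [(v == x) || _]orbC orbC
  [(u == x) || _]orbC.
Qed.

Lemma arrow_le x y t : (arrow x y <= t) = ((x, y) \in quo_set t).
Proof.
apply/quo_leP/idP=> [|xy u v]; first by apply; rewrite in_arrow !eqxx orbT.
by rewrite in_arrow => /orP[/eqP->|/andP[/eqP-> /eqP->] //]; apply: quo_refl.
Qed.

Lemma merge_le x y t :
  (merge x y <= t) = ((x, y) \in quo_set t) && ((y, x) \in quo_set t).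
Proof.
apply/quo_leP/andP=> [le_t|[xy yx] u v].
  by split; apply: le_t; rewrite in_merge !eqxx ?orbT.
rewrite in_merge => /orP[/eqP->|]; first exact: quo_refl.
by case/andP=> /orP[]/eqP-> /orP[]/eqP-> //; apply: quo_refl.
Qed.

(** Among the quasiorders in which nothing but [x] lies below [x] there is a
    largest one, and likewise for above.  To bound a join from above it is enough
    to bound its two terms, so comparison with these two quasiorders spares any
    computation of a transitive closure. *)
Lemma minimal_subproof x :
  quasiorder [set p : A * A | (p.2 == x) ==> (p.1 == x)].
Proof.
apply/quasiorderP; split=> [u|v u w]; rewrite /rel_of !inE /= ?implybb //.
by move=> uv vw; apply/implyP=> /(implyP vw); apply: implyP.
Qed.

Definition largest_with_minimal x : Quo A := MkQuo (minimal_subproof x).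

Lemma maximal_subproof x :
  quasiorder [set p : A * A | (p.1 == x) ==> (p.2 == x)].
Proof.
apply/quasiorderP; split=> [u|v u w]; rewrite /rel_of !inE /= ?implybb //.
by move=> uv vw; apply/implyP=> /(implyP uv); apply: implyP.
Qed.

Definition largest_with_maximal x : Quo A := MkQuo (maximal_subproof x).

(** The element [x] reaches [z] through [y], but no other element reaches [x],
    so of the two pairs of [merge x z] only [(x, z)] remains. *)
Lemma arrow_retarget x y z : x != y -> x != z ->
  Order.meet (merge x z) (Order.join (arrow x y) (merge y z)) = arrow x z.
Proof.
move=> xy xz; apply/le_anti/andP; split; last first.
  rewrite lexI !arrow_le; apply/andP; split.
    by rewrite in_merge !eqxx !orbT.
  have /quo_leP le1 : arrow x y <= Order.join (arrow x y) (merge y z).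
    exact: leUl.
  have /quo_leP le2 : merge y z <= Order.join (arrow x y) (merge y z).
    exact: leUr.
  apply: (@mem_quo_trans _ y); [apply: le1 | apply: le2].
    by rewrite in_arrow !eqxx orbT.
  by rewrite in_merge !eqxx !orbT.
have le_min : Order.join (arrow x y) (merge y z) <= largest_with_minimal x.
  rewrite leUx arrow_le merge_le !inE /= eqxx.
  by rewrite [y == x]eq_sym [z == x]eq_sym (negPf xy) (negPf xz).
apply/quo_leP=> u v; rewrite mem_quo_meet in_merge in_arrow.
case/andP=> uv_xz /(quo_leP _ _ le_min); rewrite inE /=; move: uv_xz.
have [//|/eqP uv /=] := eqVneq u v.
by case/andP=> /orP[]/eqP eu /orP[]/eqP ev; move: uv; rewrite eu ev ?eqxx //=;
  rewrite [z == x]eq_sym (negPf xz).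
Qed.

(** Obtained from [arrow_retarget] by reversing all relations: [z] reaches [y]
    through [x], and [y] reaches nothing else in the join. *)
Lemma arrow_resource x y z : x != y -> z != y ->
  Order.meet (merge z y) (Order.join (arrow x y) (merge x z)) = arrow z y.
Proof.
move=> xy zy; apply/le_anti/andP; split; last first.
  rewrite lexI !arrow_le; apply/andP; split.
    by rewrite in_merge !eqxx !orbT.
  have /quo_leP le1 : arrow x y <= Order.join (arrow x y) (merge x z).
    exact: leUl.
  have /quo_leP le2 : merge x z <= Order.join (arrow x y) (merge x z).
    exact: leUr.
  apply: (@mem_quo_trans _ x); [apply: le2 | apply: le1].
    by rewrite in_merge !eqxx !orbT.
  by rewrite in_arrow !eqxx orbT.
have le_max : Order.join (arrow x y) (merge x z) <= largest_with_maximal y.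
  by rewrite leUx arrow_le merge_le !inE /= (negPf xy) (negPf zy).
apply/quo_leP=> u v; rewrite mem_quo_meet in_merge in_arrow.
case/andP=> uv_zy /(quo_leP _ _ le_max); rewrite inE /=; move: uv_zy.
have [//|/eqP uv /=] := eqVneq u v.
by case/andP=> /orP[]/eqP eu /orP[]/eqP ev; move: uv; rewrite eu ev ?eqxx //=;
  rewrite [y == z]eq_sym (negPf zy).
Qed.

(** A quasiorder is the join of the arrows below it.  The point [a] supplies
    the diagonal [arrow a a] as the value of the empty join. *)
Lemma sublattice_of_arrows (a : A) (S : Quo A -> Prop) :
  sublattice S -> (forall x y, S (arrow x y)) -> forall r, S r.
Proof.
move=> latS arrS r.
have [t [St tr le_t]] : exists t, [/\ S t, t <= r &
    {in enum (quo_set r), forall p, p \in quo_set t}].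
  have: {subset enum (quo_set r) <= quo_set r} by move=> p; rewrite mem_enum.
  elim: (enum _) => [_|[x y] e IHe sub_r].
    by exists (arrow a a); split=> //; rewrite arrow_le; apply: quo_refl.
  have [|t [St tr le_t]] := IHe.
    by move=> p pe; apply: sub_r; rewrite inE pe orbT.
  exists (Order.join (arrow x y) t); split.
  - by have [] := latS _ _ (arrS x y) St.
  - by rewrite leUx arrow_le tr andbT; apply: sub_r; rewrite inE eqxx.
  - move=> p; rewrite inE => /predU1P[->|/le_t pt].
      by rewrite -arrow_le leUl.
    by case: p pt => u v; rewrite -!arrow_le => ut; apply: le_trans (leUr _ _).
suff -> : r = t by [].
apply/le_anti; rewrite tr andbT; apply/quo_leP=> u v uv.
by apply: le_t; rewrite mem_enum.
Qed.

End ArrowsAndMerges.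

Lemma cardfsU1r (K : choiceType) (X : {fset K}) (x : K) :
  #|` X `|` [fset x]| = ((x \notin X) + #|` X|)%N.
Proof. by rewrite fsetUC cardfsU1. Qed.

(** Incomparable elements are distinct, so order facts alone give both the
    cardinal and the unique comparable pair [{p, q}]. *)
Lemma one_one_two_subset4 (d : Order.disp_t) (Y : porderType d)
    (p q r s : Y) :
  p < q -> p >< r -> p >< s -> q >< r -> q >< s -> r >< s ->
  one_one_two_subset [fset p; q; r; s].
Proof.
have neq (x y : Y) : x >< y -> (y == x) = false.
  by move=> nxy; apply: contraNF nxy => /eqP->; apply: comparablexx.
move=> pq pr ps qr qs rs; split.
  rewrite !cardfsU1r cardfs1 !inE (gt_eqF pq) (neq _ _ pr) (neq _ _ ps).
  by rewrite (neq _ _ qr) (neq _ _ qs) (neq _ _ rs).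
exists [fset p; q]; split.
  split; first by apply/fsubsetP=> x; rewrite !inE => /orP[]->; rewrite ?orbT.
  by exists p, q; split; rewrite ?(lt_eqF pq) //; apply/le_comparable/ltW.
move=> P [subX [x [y [defP xy cxy]]]]; move: subX xy cxy; rewrite {P}defP.
rewrite fsubUset !fsub1set !inE -!orbA => /andP[xX yX].
have incmp (u v : Y) : u >< v -> ((u >=< v) = false) * ((v >=< u) = false).
  by move=> nuv; rewrite [v >=< u]comparable_sym (negPf nuv).
have incmpE := (incmp _ _ pr, incmp _ _ ps, incmp _ _ qr, incmp _ _ qs,
  incmp _ _ rs).
by case/or4P: xX => /eqP->; case/or4P: yX => /eqP->;
  rewrite ?eqxx ?incmpE //= fsetUC.
Qed.

Lemma in_fset4 (K : choiceType) (S : K -> Prop) (p q r s : K) :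
  (forall x, x \in [fset p; q; r; s] -> S x) -> [/\ S p, S q, S r & S s].
Proof. by move=> inS; split; apply: inS; rewrite !inE eqxx ?orbT. Qed.

Lemma card3P (A : finType) : #|A| = 3 ->
  exists a b c : A, [/\ a != b, a != c, b != c &
    forall x, [|| x == a, x == b | x == c]].
Proof.
move=> cardA; have: size (enum A) = 3 by rewrite -cardE.
have := mem_enum A; have := enum_uniq A.
case: (enum A) => [|a [|b [|c []]]] //=.
rewrite !inE negb_or !andbT => /andP[/andP[ab ac] bc] memA _.
by exists a, b, c; split=> // x; have := memA x; rewrite !inE.
Qed.

Section ThreeElements.

Variables (A : finType) (a b c : A).
Hypotheses (ab : a != b) (ac : a != c) (bc : b != c).

Definition generators : {fset Quo A} :=
  [fset arrow a b; merge a b; merge a c; merge b c].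

Lemma distinct3E :
  ((a == b) = false) * ((b == a) = false) * ((a == c) = false) *
  ((c == a) = false) * ((b == c) = false) * ((c == b) = false).
Proof.
by rewrite [b == a]eq_sym [c == a]eq_sym [c == b]eq_sym (negPf ab) (negPf ac)
  (negPf bc).
Qed.

Let le_generatorsE :=
  (arrow_le, merge_le, in_arrow, in_merge, distinct3E, eqxx).

Lemma generators_one_one_two : one_one_two_subset generators.
Proof.
apply: one_one_two_subset4; rewrite ?lt_leAnge /Order.comparable.
- by rewrite !le_generatorsE orbT.
- by rewrite !le_generatorsE.
- by rewrite !le_generatorsE.
- by rewrite !le_generatorsE.
- by rewrite !le_generatorsE.
- by rewrite !le_generatorsE.
Qed.

Hypothesis abcA : forall x, [|| x == a, x == b | x == c].

Lemma generators_generate : generates generators.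
Proof.
move=> r S latS genS.
have meetS s t : S s -> S t -> S (Order.meet s t).
  by move=> Ss St; have [] := latS _ _ Ss St.
have joinS s t : S s -> S t -> S (Order.join s t).
  by move=> Ss St; have [] := latS _ _ Ss St.
have [Sab Mab Mac Mbc] := in_fset4 genS.
have mergeS x y : x != y -> S (merge x y).
  by case/or3P: (abcA x) => /eqP->; case/or3P: (abcA y) => /eqP->;
    rewrite ?eqxx // => _; rewrite // merge_sym.
have retarget x y z : x != y -> x != z -> y != z ->
    S (arrow x y) -> S (arrow x z).
  by move=> xy xz yz Sxy; rewrite -(arrow_retarget xy xz); auto.
have resource x y z : x != y -> z != y -> x != z ->
    S (arrow x y) -> S (arrow z y).
  by move=> xy zy xz Sxy; rewrite -(arrow_resource xy zy); auto.
have Sac : S (arrow a c) by apply: (retarget a b); rewrite ?distinct3E.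
have Scb : S (arrow c b) by apply: (resource a b); rewrite ?distinct3E.
have Sbc : S (arrow b c) by apply: (resource a c); rewrite ?distinct3E.
have Sba : S (arrow b a) by apply: (retarget b c); rewrite ?distinct3E.
have Sca : S (arrow c a) by apply: (retarget c b); rewrite ?distinct3E.
have diagS x : S (arrow x x).
  suff -> : arrow x x = Order.meet (arrow a b) (arrow b a) by apply: meetS.
  apply/val_inj/setP=> -[u v]; rewrite mem_quo_meet !in_arrow.
  have [//|/eqP uv] := eqVneq u v; rewrite /=.
  have [ua|_] := eqVneq u a; last first.
    by apply/andP=> -[/eqP ux /eqP vx]; case: uv; rewrite ux.
  rewrite ua distinct3E andbF; apply/andP=> -[/eqP ax /eqP vx].
  by case: uv; rewrite ua ax vx.
apply: (sublattice_of_arrows a latS) => x y.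
by case/or3P: (abcA x) => /eqP->; case/or3P: (abcA y) => /eqP->.
Qed.

End ThreeElements.

Theorem corollary2p5 (A : finType) (cardA : #|A| = 3) :
  one_one_two_generated (Quo A).
Proof.
have [a [b [c [ab ac bc abcA]]]] := card3P cardA.
exists (generators a b c); split.
  exact: generators_one_one_two.
exact: generators_generate.
Qed.
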